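(* Let $G$ be a group, $\mathcal H$ a complex separable Hilbert space and $V\colon G\to\mathcal U(\mathcal H)$ a unitary representation which decomposes as $V=\bigoplus_{n=1}^N V_n$ on $\mathcal H=\bigoplus_{n=1}^N\mathcal H_n$, $N\in\mathbb N\cup\{\infty\}$, where the subrepresentations $V_n$ on $\mathcal H_n$ are irreducible and mutually inequivalent. Let $\mathcal V=\{V(g)\mid g\in G\}''$. Let $T\colon\mathcal D(T)\subset\mathcal H\to\mathcal H$ be a densely defined self-adjoint $G$-invariant operator. Then: (i) each orthogonal projection $P_k$ onto $\mathcal H_k$ is central in $\mathcal V$ (i.e. $P_k\in\mathcal V\cap\mathcal V'$) and reduces $T$ (i.e. $P_k\in\{T\}'$); (ii) if $N<\infty$, then $T$ is bounded and there exist $\lambda_1,\dots,\lambda_N\in\mathbb T\setminus\{-1\}$ such that $T=\bigoplus_{k=1}^N i\frac{\lambda_k-1}{\lambda_k+1}\mathbb I_{\mathcal H_k}$ with respect to the decomposition $\mathcal H=\bigoplus_k\mathcal H_k$.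
   Context: $T$ is $G$-invariant if $V(g)\mathcal D(T)\subset\mathcal D(T)$ and $TV(g)\Psi=V(g)T\Psi$ for all $g\in G$, $\Psi\in\mathcal D(T)$. For $\mathcal S\subset\mathcal L(\mathcal H)$, $\mathcal S'$ is its commutant. For a densely defined operator $T$, $\{T\}'=\{A\in\mathcal L(\mathcal H)\mid A\mathcal D(T)\subset\mathcal D(T),\ TA\Phi=AT\Phi\ \forall\Phi\in\mathcal D(T)\}$. $\mathbb T$ is the unit circle in $\mathbb C$. *)

(* Defs.v *)
(* Complex scalars: R[i] (complex numbers over a
   realType R, from mathcomp-real-closed).  A complex Hilbert space is a
   complete normed R[i]-module whose norm comes from an inner product. *)
From mathcomp Require Import all_boot all_algebra complex.
From mathcomp Require Import all_classical all_reals all_analysis.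
Import numFieldNormedType.Exports.
Import GRing.Theory Num.Theory.
Set Implicit Arguments. Unset Strict Implicit. Unset Printing Implicit Defensive.
Local Open Scope ring_scope.
Local Open Scope classical_set_scope.
Local Open Scope complex_scope.

Section Hilbert.
Variables (R : realType) (H : normedModType R[i]).

Definition inner_product (ip : H -> H -> R[i]) : Prop :=
  [/\ forall (a : R[i]) (x y z : H), ip (a *: x + y) z = a * ip x z + ip y z,
      forall x y : H, ip y x = (ip x y)^*
    & forall x : H, ip x x = `|x| ^+ 2].

Definition separable : Prop :=
  exists u : nat -> H, closure (range u) = [set: H].

Definition subspace (M : set H) : Prop :=
  M 0 /\ forall (a : R[i]) (x y : H), M x -> M y -> M (a *: x + y).

Definition closed_subspace (M : set H) : Prop := subspace M /\ closed M.

Definition span (S : set H) : set H :=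
  [set x | exists (n : nat) (a : 'I_n -> R[i]) (v : 'I_n -> H),
      (forall j, S (v j)) /\ x = \sum_(j < n) a j *: v j].

Definition linear_op (A : H -> H) : Prop :=
  forall (a : R[i]) (x y : H), A (a *: x + y) = a *: A x + A y.

Definition bounded_op (A : H -> H) : Prop :=
  linear_op A /\ exists c : R, forall x : H, `|A x| <= c%:C * `|x|.

Definition unitary (ip : H -> H -> R[i]) (U : H -> H) : Prop :=
  [/\ bounded_op U, forall y, exists x, U x = y
    & forall x y, ip (U x) (U y) = ip x y].

Definition is_orth_proj (ip : H -> H -> R[i]) (M : set H) (P : H -> H) : Prop :=
  [/\ closed_subspace M, forall x, M (P x)
    & forall x y, M y -> ip (x - P x) y = 0].

Definition commutant (S : set (H -> H)) : set (H -> H) :=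
  [set A | bounded_op A /\ forall B, S B -> forall x, A (B x) = B (A x)].

Definition op_commutant (D : set H) (T : H -> H) : set (H -> H) :=
  [set A | [/\ bounded_op A, forall x, D x -> D (A x)
             & forall x, D x -> T (A x) = A (T x)]].

Definition densely_defined (D : set H) (T : H -> H) : Prop :=
  [/\ subspace D, closure D = [set: H]
    & forall (a : R[i]) x y, D x -> D y -> T (a *: x + y) = a *: T x + T y].

Definition adjoint_domain (ip : H -> H -> R[i]) (D : set H) (T : H -> H) : set H :=
  [set y | exists z, forall x, D x -> ip (T x) y = ip x z].

(* T = T^* : same domains, and T^* y = T y on it *)
Definition self_adjoint (ip : H -> H -> R[i]) (D : set H) (T : H -> H) : Prop :=
  adjoint_domain ip D T = D /\
  forall x y, D x -> D y -> ip (T x) y = ip x (T y).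

Definition is_group (G : Type) (mul : G -> G -> G) (one : G) (inv : G -> G) : Prop :=
  [/\ forall a b c, mul a (mul b c) = mul (mul a b) c,
      forall a, mul one a = a
    & forall a, mul (inv a) a = one].

Definition unitary_rep (ip : H -> H -> R[i]) (G : Type) (mul : G -> G -> G)
  (one : G) (V : G -> H -> H) : Prop :=
  [/\ forall g, unitary ip (V g), forall x, V one x = x
    & forall g h x, V (mul g h) x = V g (V h x)].

Definition G_invariant (G : Type) (V : G -> H -> H) (D : set H) (T : H -> H) : Prop :=
  forall g, (forall x, D x -> D (V g x)) /\ (forall x, D x -> T (V g x) = V g (T x)).

Definition invariant_subspace (G : Type) (V : G -> H -> H) (M : set H) : Prop :=
  closed_subspace M /\ forall g x, M x -> M (V g x).

Definition irreducible_on (G : Type) (V : G -> H -> H) (M : set H) : Prop :=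
  (exists x, M x /\ x <> 0) /\
  forall M', invariant_subspace V M' -> M' `<=` M -> M' = [set 0] \/ M' = M.

Definition equivalent_on (ip : H -> H -> R[i]) (G : Type) (V : G -> H -> H)
  (M1 M2 : set H) : Prop :=
  exists W : H -> H,
    [/\ forall x, M1 x -> M2 (W x),
        forall y, M2 y -> exists x, M1 x /\ W x = y,
        forall (a : R[i]) x y, M1 x -> M1 y -> W (a *: x + y) = a *: W x + W y,
        forall x y, M1 x -> M1 y -> ip (W x) (W y) = ip x y
      & forall g x, M1 x -> W (V g x) = V g (W x)].

(* index set {1..N} (shifted to start at 0); N = None encodes N = infinity *)
Definition idx (N : option nat) (k : nat) : Prop :=
  if N is Some n then (k < n)%N else True.

Definition rep_decomposition (ip : H -> H -> R[i]) (G : Type) (V : G -> H -> H)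
  (N : option nat) (Hn : nat -> set H) : Prop :=
  [/\ forall k, idx N k -> invariant_subspace V (Hn k) /\ irreducible_on V (Hn k),
      forall k l, idx N k -> idx N l -> k <> l ->
        forall x y, Hn k x -> Hn l y -> ip x y = 0,
      forall k l, idx N k -> idx N l -> k <> l -> ~ equivalent_on ip V (Hn k) (Hn l)
    & closure (span [set x | exists k, idx N k /\ Hn k x]) = [set: H]].

End Hilbert.

(* Main.v *)
Require Import Defs.
From mathcomp Require Import all_boot all_order all_algebra complex.
From mathcomp Require Import all_classical all_reals all_analysis.
From mathcomp Require Import ring lra.
Import numFieldNormedType.Exports.
Import Order.TTheory GRing.Theory Num.Theory.
Set Implicit Arguments. Unset Strict Implicit. Unset Printing Implicit Defensive.
Local Open Scope ring_scope.
Local Open Scope classical_set_scope.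
Local Open Scope complex_scope.

(* Each resolvent (T + i)^-1, (T - i)^-1 is a bounded operator commuting with V,
   so everything follows from Schur's lemma for bounded operators: such an
   operator is scalar on each H_k if it is self-adjoint, and has no matrix
   entries between different components because V_k and V_l are inequivalent.
   Schur's lemma needs no spectral theorem: if A is self-adjoint and commutes
   with V, then so does |A - c|, and irreducibility applied to the kernel of
   |A - c| - (A - c) shows that A - c is semidefinite on H_k for every real c;
   the supremum of the lower bounds of A on H_k is then the scalar.  Finally
   (T + i)^-1 = r on H_k gives T = 1/r - i there, with r <> 0. *)

(** * Real-valued norm and completeness *)

(** A commutation relation for the unbounded [T] carries domain conditions. Its resolvents are
    defined everywhere and have range [D], so the invariance of [T] becomes plain membership of
    bounded operators in the commutant of V. The operator (T + i)^-1 is not self-adjoint, but its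
    adjoint is (T - i)^-1; both lie in the commutant, hence so do its real and imaginary parts, to
    which Schur's lemma applies. What replaces the functional calculus is |A|, obtained as a norm
    limit of polynomials in the square of a rescaled A. It therefore commutes with every bounded
    operator that commutes with A, in particular with V and with the projection onto H_k.
    Inequivalence by itself only says that A maps each H_k into itself; that A commutes with P_k
    also takes the same fact for the adjoint of A. On every H_k the operator [T] is a real scalar,
    whatever N is. Finiteness of N is what turns this into boundedness: every vector is then a
    finite sum of components, and [D] is a subspace. *)

Section RealNorm.
Variables (R : realType) (H : normedModType R[i]).
Implicit Types (x y z : H) (a b : R).

(** The norm of a normed [R[i]]-module is itself a complex number. Its real part lives in the
    totally ordered field [R], where suprema, infima and [lra] are available. *)
Definition nr x : R := complex.Re `|x|.

Lemma nrE x : `|x| = (nr x)%:C.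
Proof.
rewrite /nr; have := normr_ge0 x; rewrite lecE /=.
by case: (`|x|) => u v /= /andP[/eqP -> _].
Qed.

Lemma nr_ge0 x : 0 <= nr x.
Proof. by rewrite -lecR -nrE normr_ge0. Qed.

Lemma nr0 : nr 0 = 0. Proof. by rewrite /nr normr0. Qed.

Lemma nr0_eq0 x : nr x = 0 -> x = 0.
Proof. by move=> h; apply/eqP; rewrite -normr_eq0 nrE h. Qed.

Lemma ler_nrD x y : nr (x + y) <= nr x + nr y.
Proof. by rewrite -lecR rmorphD /= -!nrE ler_normD. Qed.

Lemma nrN x : nr (- x) = nr x.
Proof. by rewrite /nr normrN. Qed.

Lemma nrB x y : nr (x - y) = nr (y - x).
Proof. by rewrite -nrN opprB. Qed.

Lemma nrZ (a : R[i]) x : nr (a *: x) = complex.Re `|a| * nr x.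
Proof.
apply: complexI; rewrite rmorphM /= -!nrE normrZ; congr (_ * _).
Qed.

Lemma nrZr a x : nr (a%:C *: x) = `|a| * nr x.
Proof.
by rewrite nrZ; congr (_ * _); rewrite normc_def /= expr0n addr0 sqrtr_sqr.
Qed.

Lemma small_eq0 (c : R) x :
  (forall e : R, 0 < e -> nr x <= e * c) -> x = 0.
Proof.
move=> h; apply: nr0_eq0; apply/eqP; rewrite eq_le nr_ge0 andbT.
apply/ler_addgt0Pl => e e0; rewrite addr0.
have cp : 0 < `|c| + 1 by rewrite ltr_wpDl.
apply: le_trans (h (e / (`|c| + 1)) (divr_gt0 e0 cp)) _.
rewrite -mulrA ler_piMr ?(ltW e0)// mulrC ler_pdivrMr// mul1r.
by rewrite (le_trans (ler_norm _))// lerDl.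
Qed.

Lemma closure_nrP (A : set H) x :
  closure A x <-> forall e : R, 0 < e -> exists2 y, A y & nr (x - y) < e.
Proof.
split=> [cAx e e0|h B /nbhs_ballP[e /= e0 eB]].
  have [|y [Ay]] := cAx (ball x e%:C); first by apply: nbhsx_ballx; rewrite ltcR.
  by rewrite -ball_normE /= nrE ltcR => ?; exists y.
have eE : e = (complex.Re e)%:C.
  by move: e0; rewrite ltcE /=; case: (e) => u v /= /andP[/eqP ->].
move: e0; rewrite eE ltcR => /h[y Ay yx]; exists y; split=> //.
by apply: eB; rewrite -ball_normE /= nrE eE ltcR.
Qed.

Lemma closedP (A : set H) : closed A <->
  forall x, (forall e : R, 0 < e -> exists2 y, A y & nr (x - y) < e) -> A x.
Proof.
split=> [cA x /closure_nrP|h x /closure_nrP]; first exact: cA.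
exact: h.
Qed.

End RealNorm.

(** Completeness with an explicit rate: the error bound [d] survives in the limit. The limits taken
    below can then be handled by estimates instead of filters. *)
Lemma nr_complete (R : realType) (H : completeNormedModType R[i])
    (u : nat -> H) (d : nat -> R) :
    (forall e, 0 < e -> exists n, forall m, (n <= m)%N -> d m < e) ->
    (forall m n, nr (u m - u n) <= d m + d n) ->
  exists l, forall n, nr (u n - l) <= d n.
Proof.
move=> d0 ud.
have /cauchy_cvg/cvg_ex[l /cvg_ballP ul] : cauchy (u @ \oo).
  apply: cauchy_exP => e e0; have [|n dn] := d0 (complex.Re e / 2).
    by rewrite divr_gt0 //; move: e0; rewrite ltcE => /andP[].
  exists (u n), n => // m /= nm; rewrite -ball_normE /= nrE ltcE /=.
  move: e0; rewrite ltcE /= => /andP[-> _] /=.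
  have := ud n m; have := dn n (leqnn n); have := dn m nm; lra.
exists l => n; apply/ler_addgt0Pl => e e0.
have [k dk] := d0 (e / 2) (divr_gt0 e0 (ltr0n _ 2)).
have e2 : 0 < (e / 2)%:C by rewrite ltcR divr_gt0.
have [N _ /= uN] := ul _ e2.
have := uN (maxn N k) (leq_maxl _ _); rewrite /= -ball_normE /= nrE ltcR.
have := dk (maxn N k) (leq_maxr _ _).
have := ler_nrD (u n - u (maxn N k)) (u (maxn N k) - l).
rewrite addrA subrK (nrB l); have := ud n (maxn N k); lra.
Qed.

(** * Inner products and projections *)

Section InnerProduct.
Variables (R : realType) (H : normedModType R[i]) (ip : H -> H -> R[i]).
Hypothesis Hip : inner_product ip.
Implicit Types (x y z w : H) (a b : R).

Definition rip x y : R := complex.Re (ip x y).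

Lemma ip_conj x y : ip y x = (ip x y)^*.
Proof. by case: Hip => _ + _; apply. Qed.

Lemma ipDl x y z : ip (x + y) z = ip x z + ip y z.
Proof. by case: Hip => h _ _; rewrite -[x in LHS]scale1r h mul1r. Qed.

Lemma ip0l z : ip 0 z = 0.
Proof. by apply: (@addrI _ (ip 0 z)); rewrite -ipDl !addr0. Qed.

Lemma ipZl (a : R[i]) x z : ip (a *: x) z = a * ip x z.
Proof. by case: Hip => h _ _; rewrite -[a *: x]addr0 h ip0l addr0. Qed.

Lemma ipNl x z : ip (- x) z = - ip x z.
Proof. by rewrite -scaleN1r ipZl mulN1r. Qed.

Lemma ipBl x y z : ip (x - y) z = ip x z - ip y z.
Proof. by rewrite ipDl ipNl. Qed.

Lemma ipDr x y z : ip z (x + y) = ip z x + ip z y.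
Proof. by rewrite !(ip_conj _ z) ipDl rmorphD. Qed.

Lemma ipZr (a : R[i]) x z : ip z (a *: x) = conjc a * ip z x.
Proof. by rewrite !(ip_conj _ z) ipZl rmorphM. Qed.

Lemma ipBr x y z : ip z (x - y) = ip z x - ip z y.
Proof. by rewrite !(ip_conj _ z) ipBl rmorphB. Qed.

Lemma ip0r z : ip z 0 = 0.
Proof. by rewrite ip_conj ip0l rmorph0. Qed.

Lemma ipxx x : ip x x = (nr x ^+ 2)%:C.
Proof. by case: Hip => _ _ ->; rewrite nrE rmorphXn. Qed.

Lemma ripC x y : rip x y = rip y x.
Proof. by rewrite /rip ip_conj; case: (ip y x). Qed.

Lemma ripDl x y z : rip (x + y) z = rip x z + rip y z.
Proof. by rewrite /rip ipDl raddfD. Qed.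

Lemma ripZl a x z : rip (a%:C *: x) z = a * rip x z.
Proof. by rewrite /rip ipZl; case: (ip x z) => u v /=; rewrite mul0r subr0. Qed.

Lemma ripBl x y z : rip (x - y) z = rip x z - rip y z.
Proof. by rewrite /rip ipBl raddfB. Qed.

Lemma ripDr x y z : rip z (x + y) = rip z x + rip z y.
Proof. by rewrite !(ripC z) ripDl. Qed.

Lemma ripBr x y z : rip z (x - y) = rip z x - rip z y.
Proof. by rewrite !(ripC z) ripBl. Qed.

Lemma ripZr a x z : rip z (a%:C *: x) = a * rip z x.
Proof. by rewrite !(ripC z) ripZl. Qed.

Lemma ripNl x z : rip (- x) z = - rip x z.
Proof. by rewrite -sub0r ripBl /rip ip0l sub0r. Qed.

Lemma ripNr x z : rip z (- x) = - rip z x.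
Proof. by rewrite !(ripC z) ripNl. Qed.

Lemma ripxx x : rip x x = nr x ^+ 2.
Proof. by rewrite /rip ipxx. Qed.

Lemma nrD2 x y : nr (x + y) ^+ 2 = nr x ^+ 2 + 2 * rip x y + nr y ^+ 2.
Proof. rewrite -!ripxx ripDl !ripDr (ripC y x); ring. Qed.

Lemma nrB2 x y : nr (x - y) ^+ 2 = nr x ^+ 2 - 2 * rip x y + nr y ^+ 2.
Proof. rewrite -!ripxx ripBl !ripBr (ripC y x); ring. Qed.

Lemma rip_le x y : rip x y <= nr x * nr y.
Proof.
have [x0|x0] := eqVneq (nr x) 0.
  by rewrite (nr0_eq0 x0) /rip ip0l nr0 mul0r.
have [y0|y0] := eqVneq (nr y) 0.
  by rewrite (nr0_eq0 y0) /rip ip0r nr0 mulr0.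
have xy : 0 < nr x * nr y by rewrite mulr_gt0 // lt_def ?x0 ?y0 nr_ge0.
have := sqr_ge0 (nr ((nr y)%:C *: x - (nr x)%:C *: y)).
rewrite nrB2 !nrZr !ger0_norm ?nr_ge0// ripZl ripZr => h.
rewrite -(ler_pM2l xy); nra.
Qed.

Lemma rip_abs_le x y : `|rip x y| <= nr x * nr y.
Proof.
rewrite ler_norml rip_le andbT lerNl -ripNl.
by rewrite (le_trans (rip_le _ _))// nrN.
Qed.

(** The choice c = 1 compares the real parts and c = -i the imaginary parts. Estimates can thus be
    made on the real form [rip] alone. *)
Lemma rip_ext x y z w : (forall c : R[i], rip (c *: x) y = rip (c *: z) w) ->
  ip x y = ip z w.
Proof.
move=> h; have := h 1; have := h (- 'i); rewrite /rip !ipZl !mul1r.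
by case: (ip x y) => u v; case: (ip z w) => p q /=; rewrite !mulNr !mul1r !mul0r
  oppr0 !sub0r !opprK => -> ->.
Qed.

Lemma ip_eq0 x : (forall y, ip x y = 0) -> x = 0.
Proof.
move=> /(_ x); rewrite ipxx => /complexI/eqP; rewrite sqrf_eq0 => /eqP.
exact: nr0_eq0.
Qed.

Lemma ip_injr x y : (forall z, ip z x = ip z y) -> x = y.
Proof.
move=> h; apply/eqP; rewrite -subr_eq0; apply/eqP/ip_eq0 => z.
by rewrite ip_conj ipBr h subrr rmorph0.
Qed.

Lemma ip_injl x y : (forall z, ip x z = ip y z) -> x = y.
Proof. by move=> h; apply: ip_injr => z; rewrite !(ip_conj _ z) h. Qed.

End InnerProduct.

(* Pairing with an arbitrary vector turns an identity between linear
   combinations into a ring identity in R[i]. *)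
Local Ltac vector_ring Hip := apply: (ip_injl Hip) => ?;
  rewrite !(ipDl Hip, ipNl Hip, ipZl Hip, ip0l Hip); ring.

Section Subspace.
Variables (R : realType) (H : normedModType R[i]) (M : set H).
Hypothesis subM : Defs.subspace M.

Lemma subspace0 : M 0. Proof. by case: subM. Qed.

Lemma subspaceZ (a : R[i]) x : M x -> M (a *: x).
Proof. by move=> Mx; rewrite -[_ *: _]addr0; case: subM => M0 h; exact: h. Qed.

Lemma subspaceD x y : M x -> M y -> M (x + y).
Proof. by move=> Mx My; rewrite -[x]scale1r; case: subM => _ h; exact: h. Qed.

Lemma subspaceB x y : M x -> M y -> M (x - y).
Proof.
by move=> Mx My; rewrite -scaleN1r; apply: subspaceD => //; exact: subspaceZ.
Qed.

End Subspace.

Lemma inv_nat_small (R : realType) (e : R) : 0 < e ->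
  exists n, forall m, (n <= m)%N -> m.+1%:R^-1 < e.
Proof.
move=> e0; exists (Num.truncn e^-1) => m nm.
rewrite invf_plt ?posrE// (lt_le_trans (truncnS_gt _))//.
by rewrite ler_nat ltnS.
Qed.

Section Projection.
Variables (R : realType) (H : completeNormedModType R[i]) (ip : H -> H -> R[i]).
Hypothesis Hip : inner_product ip.
Variable M : set H.
Hypothesis cM : closed_subspace M.

(** First variation with an error term: moving [m] along [y] by the optimal step r / |y|^2 lowers
    the squared distance to [x] by r^2 / |y|^2, a gain that cannot exceed [eta]. *)
Lemma near_minimizer_orth x m (delta eta : R) :
  M m -> (forall y, M y -> delta <= nr (x - y) ^+ 2) ->
  nr (x - m) ^+ 2 <= delta + eta ->
  forall y, M y -> rip ip (x - m) y ^+ 2 <= eta * nr y ^+ 2.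
Proof.
move=> Mm dM mM y My; have subM := cM.1.
have [y0|y0] := eqVneq (nr y) 0.
  by rewrite (nr0_eq0 y0) /rip (ip0r Hip) nr0 expr0n mulr0.
have yp : 0 < nr y by rewrite lt_def y0 nr_ge0.
set r := rip _ _ _.
have := dM (m + (r / nr y ^+ 2)%:C *: y) (subspaceD subM Mm (subspaceZ subM _ My)).
rewrite opprD addrA (nrB2 Hip) (ripZr Hip) nrZr exprMn real_normK ?num_real// -/r => h.
have h2 : r ^+ 2 / nr y ^+ 2 <= eta.
  have e1 : r / nr y ^+ 2 * r = r ^+ 2 / nr y ^+ 2 by ring.
  have e2 : (r / nr y ^+ 2) ^+ 2 * nr y ^+ 2 = r ^+ 2 / nr y ^+ 2 by field.
  move: h; rewrite e1 e2; lra.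
by rewrite -ler_pdivrMr// exprn_gt0.
Qed.

Lemma projection_exists x :
  exists2 p, M p & forall y, M y -> ip (x - p) y = 0.
Proof.
have subM := cM.1.
pose S := [set nr (x - y) ^+ 2 | y in M].
have S0 : S !=set0 by exists (nr (x - 0) ^+ 2), 0 => //; exact: subspace0.
have lS : has_lbound S by exists 0 => _ [y _ <-]; rewrite sqr_ge0.
have dS y : M y -> inf S <= nr (x - y) ^+ 2 by move=> My; apply: ge_inf => //; exists y.
pose e n : R := n.+1%:R^-1.
have e0 n : 0 < e n by rewrite invr_gt0.
have /choice[m mP] : forall n, exists y, M y /\ nr (x - y) ^+ 2 <= inf S + e n ^+ 2.
  move=> n; have e2 : 0 < e n ^+ 2 by rewrite exprn_gt0.
  have [_ [y My <-] /ltW yS] := inf_adherent e2 (conj S0 lS).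
  by exists y.
(* Parallelogram law: the midpoint of [m n] and [m k] lies in [M], so its squared distance to [x] is
   at least the infimum. The slack is chosen as a square so that the distances are linear in [e]. *)
have mm n k : nr (m n - m k) <= 2 * e n + 2 * e k.
  rewrite -(@ler_pXn2r _ 2) ?nnegrE ?nr_ge0 ?addr_ge0 ?mulr_ge0 ?(ltW (e0 _))//.
  have [Mn hn] := mP n; have [Mk hk] := mP k.
  pose h : R := 2^-1; have := dS (h%:C *: (m n + m k)) (subspaceZ subM _ (subspaceD subM Mn Mk)).
  move: hn hk; rewrite !(nrB2 Hip) (ripZr Hip) nrZr exprMn real_normK ?num_real//.
  rewrite (ripDr Hip) (nrD2 Hip).
  have -> : h ^+ 2 = 4^-1 by rewrite /h; field.
  have -> : (2 * e n + 2 * e k) ^+ 2 =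
    4 * e n ^+ 2 + 8 * (e n * e k) + 4 * e k ^+ 2 by ring.
  have := mulr_gt0 (e0 n) (e0 k); have := sqr_ge0 (e n); have := sqr_ge0 (e k).
  rewrite /h; lra.
have [||p pP] := @nr_complete _ _ m (fun n => 2 * e n).
- move=> a a0; have [n nP] := inv_nat_small (divr_gt0 a0 (ltr0n _ 2)).
  by exists n => k /nP; rewrite -/(e k); lra.
- exact: mm.
have Mp : M p.
  move/closedP: cM.2; apply => a a0.
  have [n /(_ n (leqnn n)) nP] := inv_nat_small (divr_gt0 a0 (ltr0n _ 2)).
  exists (m n); first by have [] := mP n.
  rewrite nrB; have := pP n; move: nP; rewrite -/(e n); lra.
exists p => //; suff h y : M y -> rip ip (x - p) y = 0.
  move=> y My; rewrite -(ip0l Hip y); apply: (rip_ext Hip) => c.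
  rewrite scaler0 {2}/rip (ip0l Hip) /=.
  have -> : rip ip (c *: (x - p)) y = rip ip (x - p) (conjc c *: y).
    by rewrite /rip (ipZl Hip) (ipZr Hip) conjcK.
  by apply: h; exact: subspaceZ.
move=> My.
(* One [e n] comes from near-minimality of [m n], two from its distance to [p]. *)
have small n : `|rip ip (x - p) y| <= 3 * nr y * e n.
  have [Mn hn] := mP n.
  have -> : x - p = (x - m n) + (m n - p) by rewrite addrA subrK.
  rewrite (ripDl Hip) (le_trans (ler_normD _ _))//.
  have h1 : `|rip ip (x - m n) y| <= e n * nr y.
    rewrite -(@ler_pXn2r _ 2) ?nnegrE ?mulr_ge0 ?nr_ge0 ?(ltW (e0 _))//.
    by rewrite real_normK ?num_real// exprMn; exact: near_minimizer_orth hn _ My.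
  have h2 := rip_abs_le Hip (m n - p) y.
  have h3 := ler_wpM2r (nr_ge0 y) (pP n); lra.
apply/eqP; rewrite -normr_eq0 eq_le normr_ge0 andbT.
apply/ler_addgt0Pl => a a0; rewrite addr0.
have k0 : 0 < 3 * nr y + 1 by have := nr_ge0 y; lra.
have [n /(_ n (leqnn n)) nP] := inv_nat_small (divr_gt0 a0 k0).
move: nP; rewrite ltr_pdivlMr// -/(e n) => nP.
have := small n; have := e0 n; lra.
Qed.

End Projection.

(** * Bounded operators and adjoints *)

Section Operator.
Variables (R : realType) (H : normedModType R[i]).
Implicit Types (A B C : H -> H) (x y : H).

Section Linear.
Variable A : H -> H.
Hypothesis lA : linear_op A.

Lemma linop0 : A 0 = 0.
Proof.
have := lA 1 0 0; rewrite !scale1r addr0 => h.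
by apply: (@addrI _ (A 0)); rewrite -h addr0.
Qed.

Lemma linopD x y : A (x + y) = A x + A y.
Proof. by rewrite -[x in LHS]scale1r lA scale1r. Qed.

Lemma linopZ (a : R[i]) x : A (a *: x) = a *: A x.
Proof. by rewrite -[a *: x]addr0 lA linop0 addr0. Qed.

Lemma linopB x y : A (x - y) = A x - A y.
Proof. by rewrite -scaleN1r linopD linopZ scaleN1r. Qed.

End Linear.

Lemma bounded_opP A : bounded_op A <->
  linear_op A /\ exists2 c : R, 0 < c & forall x, nr (A x) <= c * nr x.
Proof.
split=> -[lA [c]].
  move=> hc; split=> //; exists (`|c| + 1) => [|x]; first by rewrite ltr_wpDl.
  have := hc x; rewrite !nrE -rmorphM lecR => /le_trans; apply.
  by rewrite ler_wpM2r ?nr_ge0// (le_trans (ler_norm _))// lerDl.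
by move=> c0 hc; split=> //; exists c => x; rewrite !nrE -rmorphM lecR.
Qed.

Lemma bounded_id : bounded_op (@id H).
Proof. by apply/bounded_opP; split=> //; exists 1 => // x; rewrite mul1r. Qed.

Lemma bounded_comp A B : bounded_op A -> bounded_op B -> bounded_op (A \o B).
Proof.
move=> /bounded_opP[lA [a a0 ha]] /bounded_opP[lB [b b0 hb]].
apply/bounded_opP; split; first by move=> k x y /=; rewrite lB lA.
exists (a * b) => [|x /=]; first exact: mulr_gt0.
by rewrite (le_trans (ha _))// -mulrA ler_pM2l.
Qed.

Lemma bounded_lincomb (k : R[i]) A B : bounded_op A -> bounded_op B ->
  bounded_op (fun x => k *: A x + B x).
Proof.
move=> /bounded_opP[lA [a a0 ha]] /bounded_opP[lB [b b0 hb]].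
apply/bounded_opP; split.
  move=> l x y; rewrite lB lA !scalerDr !scalerA (mulrC k) -!addrA.
  by congr (_ + _); rewrite addrCA.
exists (complex.Re `|k| * a + b) => [|x].
  rewrite ltr_wpDl// mulr_ge0 ?(ltW a0)//.
  by have := normr_ge0 k; rewrite lecE => /andP[].
rewrite (le_trans (ler_nrD _ _))// mulrDl lerD// nrZ -mulrA ler_wpM2l//.
by have := normr_ge0 k; rewrite lecE => /andP[].
Qed.

Lemma bounded_scale (k : R[i]) A : bounded_op A ->
  bounded_op (fun x => k *: A x).
Proof.
move=> bA; have := bounded_lincomb (k - 1) bA bA.
by under eq_fun do rewrite scalerBl scale1r subrK.
Qed.

Lemma kernel_closed_subspace A : bounded_op A ->
  closed_subspace [set x | A x = 0].
Proof.
move=> /bounded_opP[lA [c c0 hc]]; split.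
  split=> [|a x y /= Ax Ay]; first exact: linop0.
  by rewrite lA Ax Ay scaler0 addr0.
apply/closedP => x h /=; apply: (@small_eq0 _ _ c) => e e0.
have [y /= Ay xy] := h e e0.
have -> : A x = A (x - y) by rewrite (linopB lA) Ay subr0.
by rewrite (le_trans (hc _))// mulrC ler_wpM2r ?ltW.
Qed.

End Operator.

Section Adjoint.
Variables (R : realType) (H : completeNormedModType R[i]) (ip : H -> H -> R[i]).
Hypothesis Hip : inner_product ip.

(** Riesz representation of the functional f(x) = <A x, y>. Its kernel is closed; if f is not zero,
    take w orthogonal to the kernel with f(w) nonzero. Then x - (f(x) / f(w)) w is in the kernel,
    hence orthogonal to w, which forces the multiple of w that represents f. *)
Lemma adjoint_vector (A : H -> H) y : bounded_op A ->
  exists z, forall x, ip (A x) y = ip x z.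
Proof.
move=> /bounded_opP[lA [c c0 hc]].
have [A0|/existsNP[x0 /eqP fx0]] := pselect (forall x, ip (A x) y = 0).
  by exists 0 => x; rewrite A0 (ip0r Hip).
pose M := [set x | ip (A x) y = 0].
have cM : closed_subspace M.
  split.
    split=> [|a u v hu hv]; first by rewrite /M /= (linop0 lA) (ip0l Hip).
    by move: hu hv; rewrite /M /= lA (ipDl Hip) (ipZl Hip) => -> ->; rewrite mulr0 addr0.
  apply/closedP => x h; rewrite /M /= -(ip0l Hip y); apply: (rip_ext Hip) => k.
  rewrite scaler0 {2}/rip (ip0l Hip) /=.
  apply/eqP; rewrite -normr_eq0 eq_le normr_ge0 andbT.
  apply/ler_addgt0Pl => e e0; rewrite addr0.
  set K := complex.Re `|k| * c * nr y + 1.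
  have k0 : 0 <= complex.Re `|k| by have := normr_ge0 k; rewrite lecE => /andP[].
  have K0 : 0 < K by rewrite ltr_wpDl// !mulr_ge0 ?nr_ge0// ltW.
  have [u Mu xu] := h (e / K) (divr_gt0 e0 K0).
  have -> : rip ip (k *: A x) y = rip ip (k *: A (x - u)) y.
    by rewrite (linopB lA) scalerBr (ripBl Hip) {3}/rip (ipZl Hip k (A u)) Mu mulr0
      subr0.
  rewrite (le_trans (rip_abs_le Hip _ _))// nrZ.
  have h1 : complex.Re `|k| * nr (A (x - u)) <= complex.Re `|k| * (c * (e / K)).
    by rewrite ler_wpM2l// (le_trans (hc _))// ler_pM2l// ltW.
  rewrite (le_trans (ler_wpM2r (nr_ge0 y) h1))//.
  have -> : complex.Re `|k| * (c * (e / K)) * nr y =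
    e * (complex.Re `|k| * c * nr y / K) by ring.
  by rewrite ler_piMr ?(ltW e0)// ler_pdivrMr// mul1r lerDl.
have [p Mp pP] := projection_exists Hip cM x0.
pose w := x0 - p.
have fw : ip (A w) y = ip (A x0) y by rewrite (linopB lA) (ipBl Hip) Mp subr0.
have w0 : ip w w != 0.
  rewrite (ipxx Hip); apply: contra fx0 => /eqP/complexI/eqP.
  rewrite sqrf_eq0 => /eqP/nr0_eq0 w0.
  by rewrite -fw w0 (linop0 lA) (ip0l Hip).
exists (conjc (ip (A w) y / ip w w) *: w) => x.
rewrite (ipZr Hip) conjcK.
set k := ip (A x) y / ip (A w) y.
have : M (x - k *: w).
  rewrite /M /= (linopB lA) (linopZ lA) (ipBl Hip) (ipZl Hip) divfK ?subrr// fw.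
  exact: fx0.
move=> /pP; rewrite -/w (ipBr Hip) (ipZr Hip) => /eqP; rewrite subr_eq0 => /eqP.
move=> /(congr1 conjc).
have -> : conjc (conjc k * ip w w) = k * conjc (ip w w).
  by rewrite -[in RHS](conjcK k); exact: rmorphM.
rewrite -!(ip_conj Hip) => ->.
by rewrite /k fw; field; rewrite w0 fx0.
Qed.

Lemma adjoint_exists (A : H -> H) : bounded_op A ->
  exists2 B, bounded_op B & forall x y, ip (A x) y = ip x (B y).
Proof.
move=> bA; have /choice[B AB] : forall y, exists z, forall x, ip (A x) y = ip x z.
  by move=> y; exact: adjoint_vector.
exists B => [|x y]; last exact: AB.
move/bounded_opP: bA => [lA [c c0 hc]]; apply/bounded_opP; split.
  move=> a x y; apply: (ip_injr Hip) => z.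
  by rewrite -AB !(ipDr Hip) !(ipZr Hip) !AB.
exists c => // y; have [->|B0] := eqVneq (nr (B y)) 0.
  by rewrite mulr_ge0 ?nr_ge0// ltW.
have Bp : 0 < nr (B y) by rewrite lt_def B0 nr_ge0.
rewrite -(ler_pM2l Bp) -expr2 -(ripxx Hip) /rip -AB -/(rip _ _ _).
rewrite (le_trans (rip_le Hip _ _))// mulrA.
by rewrite ler_wpM2r ?nr_ge0// mulrC hc.
Qed.

End Adjoint.

(** * The absolute value of a self-adjoint operator *)

Section ScalarIteration.
Variable R : realType.

(** Iteration of t -> (1 + t^2) / 2 from 0. It increases to the fixed point 1, a double root, so
    convergence is only of order 1/n. *)
Fixpoint sqrt_bound (n : nat) : R :=
  if n is m.+1 then (1 + sqrt_bound m ^+ 2) / 2 else 0.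

Lemma sqrt_bound_ge0 n : 0 <= sqrt_bound n.
Proof. by case: n => //= n; rewrite divr_ge0// addr_ge0// sqr_ge0. Qed.

Lemma sqrt_bound_le1 n : sqrt_bound n <= 1.
Proof. by elim: n => [|n IH] /=; [lra|have := sqrt_bound_ge0 n; nra]. Qed.

Lemma sqrt_bound_leS n : sqrt_bound n <= sqrt_bound n.+1.
Proof. by have := sqr_ge0 (1 - sqrt_bound n) => /=; nra. Qed.

(** The gap d = 1 - t evolves by d -> d - d^2 / 2, so 2 / d grows by at least 1 at each step,
    starting from 2. *)
Lemma sqrt_bound_cvg n : 1 - sqrt_bound n <= 2 / n.+2%:R.
Proof.
elim: n => [|n IH]; first by rewrite /= subr0 divff.
have := sqrt_bound_ge0 n; have := sqrt_bound_le1 n.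
rewrite ler_pdivlMr// in IH; rewrite ler_pdivlMr//=.
move: IH; rewrite -(natr1 n.+2) -(natr1 n.+1) -(natr1 n).
have : 0 <= n%:R :> R by [].
move: (sqrt_bound n) (n%:R : R) => t k; set d := 1 - t.
have -> : 1 - (1 + t ^+ 2) / 2 = d - d ^+ 2 / 2 by rewrite /d; field.
move=> k0 hd t1 t0; have d0 : 0 <= d by rewrite /d; lra.
have d1 : d <= 1 by rewrite /d; lra.
clearbody d.
have [h|h] := lerP (d * (k + 3)) 2; first by nra.
by nra.
Qed.

Lemma sqrt_bound_small (c e : R) : 0 < e ->
  exists n, forall m, (n <= m)%N -> (1 - sqrt_bound m) * c < e.
Proof.
move=> e0; have k0 : 0 < 2 * `|c| + 1 by rewrite ltr_wpDl// mulr_ge0.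
have [n nP] := inv_nat_small (divr_gt0 e0 k0).
exists n => m nm; have := nP m.+1 (leqW nm); rewrite ltr_pdivlMr// => h.
have := sqrt_bound_cvg m; have := ler_norm c; have := sqrt_bound_le1 m.
move: h (sqrt_bound m); set u := m.+2%:R^-1 => h t t1 c1 tu.
have u0 : 0 < u by rewrite invr_gt0.
have := normr_ge0 c; move: tu; rewrite -/u; nra.
Qed.

End ScalarIteration.

Section SquareRoot.
Variables (R : realType) (H : completeNormedModType R[i]) (ip : H -> H -> R[i]).
Hypothesis Hip : inner_product ip.

Section Contraction.
Variable A : H -> H.
Hypothesis lA : linear_op A.
Hypothesis A1 : forall x, nr (A x) <= nr x.
Hypothesis sA : forall x y, ip (A x) y = ip x (A y).

Let h : R := 2^-1.
Local Notation t := (@sqrt_bound R).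

(* Y_{n+1} = (X + Y_n^2) / 2 with X = 1 - A^2 converges to Y with
   (1 - Y)^2 = 1 - X = A^2.  Its increments are dominated by those of the same
   iteration for the scalar X = 1, namely sqrt_bound, which tends to 1. *)
Fixpoint sqrt_iter (n : nat) : H -> H :=
  if n is m.+1 then
    fun x => h%:C *: (x - A (A x) + sqrt_iter m (sqrt_iter m x))
  else fun=> 0.
Local Notation Y := sqrt_iter.

(** The square of the left side is |x|^2 - 2 |A x|^2 + |A (A x)|^2, where the last term is at most
    |A x|^2. So X = 1 - A^2 has norm at most 1, as the comparison with the scalar iteration
    requires. *)
Lemma nr_defect_le x : nr (x - A (A x)) <= nr x.
Proof.
rewrite -(@ler_pXn2r _ 2) ?nnegrE ?nr_ge0// (nrB2 Hip).
rewrite /rip -sA -/(rip _ _ _) (ripxx Hip).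
have : nr (A (A x)) ^+ 2 <= nr (A x) ^+ 2 by rewrite ler_pXn2r ?nnegrE ?nr_ge0.
have := sqr_ge0 (nr (A x)); lra.
Qed.

Lemma sqrt_iter_linear n : linear_op (Y n).
Proof.
elim: n => [|n IH] a x y /=; first by rewrite scaler0 addr0.
by rewrite !(lA, IH); vector_ring Hip.
Qed.

Lemma sqrt_iterS n x :
  Y n.+1 x = h%:C *: (x - A (A x) + Y n (Y n x)).
Proof. by []. Qed.

Lemma nr_sqrt_iter n x : nr (Y n x) <= t n * nr x.
Proof.
elim: n x => [|n IH] x /=; first by rewrite nr0 mul0r.
have -> : (1 + t n ^+ 2) / 2 * nr x = h * (nr x + t n * (t n * nr x)).
  by rewrite /h; field.
rewrite nrZr ger0_norm ?invr_ge0// ler_wpM2l ?invr_ge0//.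
rewrite (le_trans (ler_nrD _ _))// lerD ?nr_defect_le//.
by rewrite (le_trans (IH _))// ler_wpM2l// sqrt_bound_ge0.
Qed.

(** A difference of squares splits as Y'Y' - YY = Y'(Y' - Y) + (Y' - Y)Y. The scalar iteration
    splits the same way, so bounding each factor gives exactly its increment. *)
Lemma nr_sqrt_iterS n x : nr (Y n.+1 x - Y n x) <= (t n.+1 - t n) * nr x.
Proof.
elim: n x => [|n IH] x.
  by rewrite !subr0 nr_sqrt_iter.
have -> : Y n.+2 x - Y n.+1 x = h%:C *: (Y n.+1 (Y n.+1 x) - Y n (Y n x)).
  rewrite sqrt_iterS [in X in _ - X]sqrt_iterS -scalerBr; congr (_ *: _).
  by rewrite opprD addrACA subrr add0r.
have -> : Y n.+1 (Y n.+1 x) - Y n (Y n x) =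
    Y n.+1 (Y n.+1 x - Y n x) + (Y n.+1 (Y n x) - Y n (Y n x)).
  by rewrite (linopB (sqrt_iter_linear _)) addrA subrK.
rewrite nrZr ger0_norm ?invr_ge0//.
have h1 := nr_sqrt_iter n.+1 (Y n.+1 x - Y n x).
have h2 := ler_wpM2l (sqrt_bound_ge0 R n.+1) (IH x).
have h3 := IH (Y n x).
have d0 : 0 <= t n.+1 - t n by rewrite subr_ge0 sqrt_bound_leS.
have h4 := ler_wpM2l d0 (nr_sqrt_iter n x).
have h5 := ler_nrD (Y n.+1 (Y n.+1 x - Y n x)) (Y n.+1 (Y n x) - Y n (Y n x)).
have -> : (t n.+2 - t n.+1) * nr x = h * (t n.+1 * ((t n.+1 - t n) * nr x) +
    (t n.+1 - t n) * (t n * nr x)).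
  have tS m : t m.+1 = (1 + t m ^+ 2) / 2 by [].
  by rewrite (tS n.+1) [in X in _ - X]tS /h; field.
by rewrite ler_wpM2l ?invr_ge0//; lra.
Qed.

Lemma nr_sqrt_iterB m n x : (n <= m)%N ->
  nr (Y m x - Y n x) <= (t m - t n) * nr x.
Proof.
move=> /subnK <-; elim: (m - n)%N => [|k IH]; first by rewrite !subrr nr0 mul0r.
have := nr_sqrt_iterS (k + n) x; rewrite addSn => h1.
have := ler_nrD (Y (k + n).+1 x - Y (k + n) x) (Y (k + n) x - Y n x).
by rewrite addrA subrK; lra.
Qed.

Lemma sqrt_iter_cvg x : exists l, forall n, nr (Y n x - l) <= (1 - t n) * nr x.
Proof.
apply: nr_complete => [e e0|m n]; first exact: sqrt_bound_small.
have x0 := nr_ge0 x.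
have tm := sqrt_bound_le1 R m; have tn := sqrt_bound_le1 R n.
case: (leqP n m) => [|/ltnW] /nr_sqrt_iterB-/(_ x); last rewrite nrB; nra.
Qed.

Lemma sqrt_iter_comm (C : H -> H) n x : bounded_op C ->
  (forall x, C (A x) = A (C x)) -> C (Y n x) = Y n (C x).
Proof.
move=> [lC _] CA; elim: n x => [|n IH] x /=; first exact: linop0.
by rewrite (linopZ lC) (linopD lC) (linopB lC) !CA !IH.
Qed.

Lemma vanish_of_iter (K : R) (z : H) :
  (forall n, nr z <= (1 - t n) * K) -> z = 0.
Proof.
move=> zK; apply: (@small_eq0 _ _ 1) => e e0; rewrite mulr1.
have [n /(_ n (leqnn n))] := sqrt_bound_small K e0.
by move=> /ltW; exact: le_trans.
Qed.

Lemma abs_contraction : exists S, [/\ bounded_op S, forall x, S (S x) = A (A x),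
  forall x, 0 <= rip ip (S x) x
  & forall C, bounded_op C -> (forall x, C (A x) = A (C x)) ->
      forall x, C (S x) = S (C x)].
Proof.
have /choice[L YL] := sqrt_iter_cvg.
have LY n x : nr (L x - Y n x) <= (1 - t n) * nr x by rewrite nrB YL.
(* At n = 0 both [Y 0] and [t 0] are 0, so the error bound is already the norm bound. *)
have L1 x : nr (L x) <= nr x.
  by have := YL x 0; rewrite /= sub0r nrN subr0 mul1r.
have lL : linear_op L.
  move=> a x y; apply/eqP; rewrite -subr_eq0; apply/eqP.
  apply: (@vanish_of_iter (nr (a *: x + y) + complex.Re `|a| * nr x + nr y)) => n.
  have -> : L (a *: x + y) - (a *: L x + L y) =
      (L (a *: x + y) - Y n (a *: x + y)) + (a *: (Y n x - L x) + (Y n y - L y)).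
    by rewrite sqrt_iter_linear; vector_ring Hip.
  rewrite (le_trans (ler_nrD _ _))// -addrA mulrDr lerD// (le_trans (ler_nrD _ _))//.
  rewrite mulrDr lerD// nrZ mulrCA ler_wpM2l//.
  by have := normr_ge0 a; rewrite lecE => /andP[].
have bL : bounded_op L.
  by apply/bounded_opP; split=> //; exists 1 => // x; rewrite mul1r.
have CL C : bounded_op C -> (forall x, C (A x) = A (C x)) ->
    forall x, C (L x) = L (C x).
  move=> bC CA x; have [lC [c c0 hc]] := (bounded_opP C).1 bC.
  apply/eqP; rewrite -subr_eq0; apply/eqP.
  apply: (@vanish_of_iter (c * nr x + nr (C x))) => n.
  have -> : C (L x) - L (C x) = C (L x - Y n x) + (Y n (C x) - L (C x)).
    by rewrite (linopB lC) sqrt_iter_comm// addrA subrK.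
  rewrite (le_trans (ler_nrD _ _))// mulrDr lerD//.
  by rewrite (le_trans (hc _))// mulrCA ler_wpM2l// ltW.
have fixL x : L x = h%:C *: (x - A (A x) + L (L x)).
  apply/eqP; rewrite -subr_eq0; apply/eqP.
  apply: (@vanish_of_iter (3 * nr x)) => n.
  have -> : L x - h%:C *: (x - A (A x) + L (L x)) =
      (L x - Y n.+1 x) +
      h%:C *: (Y n (Y n x - L x) + (Y n (L x) - L (L x))).
    by rewrite (linopB (sqrt_iter_linear n)) sqrt_iterS; vector_ring Hip.
  have h1 := LY n.+1 x; have h2 := YL (L x) n.
  have h3 := nr_sqrt_iter n (Y n x - L x).
  have h4 := ler_wpM2l (sqrt_bound_ge0 R n) (YL x n).
  have h5 := ler_nrD (Y n (Y n x - L x)) (Y n (L x) - L (L x)).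
  have h6 := ler_nrD (L x - Y n.+1 x)
    (h%:C *: (Y n (Y n x - L x) + (Y n (L x) - L (L x)))).
  have t0 := sqrt_bound_ge0 R n; have t1 := sqrt_bound_le1 R n.
  have tS := sqrt_bound_leS R n.
  have u0 : 0 <= 1 - t n by lra.
  have h7 := ler_wpM2l u0 (L1 x).
  have h8 : (1 - t n.+1) * nr x <= (1 - t n) * nr x.
    by rewrite ler_wpM2r ?nr_ge0// lerD2l lerN2.
  have h9 : t n * ((1 - t n) * nr x) <= (1 - t n) * nr x.
    by rewrite ler_piMl// mulr_ge0 ?nr_ge0.
  have := nr_ge0 (Y n (Y n x - L x) + (Y n (L x) - L (L x))).
  by move: h6; rewrite nrZr ger0_norm ?invr_ge0// /h; lra.
(* Squaring 1 - L and substituting [fixL] leaves A^2; positivity follows from [L1], since <L x, x>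
   is at most |x|^2. *)
exists (fun x => x - L x); split=> [||x|C bC CA x].
- have -> : (fun x => x - L x) = (fun x => (-1) *: L x + x).
    by apply/funext => x; rewrite scaleN1r addrC.
  by apply: bounded_lincomb => //; exact: bounded_id.
- move=> x; rewrite (linopB lL).
  suff -> : L (L x) = 2 *: L x - x + A (A x) by vector_ring Hip.
  rewrite [in 2 *: _]fixL scalerA.
  have -> : 2 * h%:C = 1 :> R[i].
    by rewrite -[2](rmorph_nat (real_complex R) 2) -rmorphM divff.
  by vector_ring Hip.
- have := rip_le Hip (L x) x; rewrite (ripBl Hip) (ripxx Hip).
  by have := ler_wpM2r (nr_ge0 x) (L1 x); lra.
- by have [lC _] := bC; rewrite (linopB lC) CL.
Qed.

End Contraction.

(** Dividing [A] by a bound [c] reduces to a contraction. The last clause is what later makes |A|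
    commute with V and with the projections. *)
Lemma abs_exists (A : H -> H) : bounded_op A ->
    (forall x y, ip (A x) y = ip x (A y)) ->
  exists S, [/\ bounded_op S, forall x, S (S x) = A (A x),
    forall x, 0 <= rip ip (S x) x
  & forall C, bounded_op C -> (forall x, C (A x) = A (C x)) ->
      forall x, C (S x) = S (C x)].
Proof.
move=> bA sA; have [lA [c c0 hc]] := (bounded_opP A).1 bA.
have cK : c%:C * (c^-1)%:C = 1 :> R[i] by rewrite -rmorphM divff ?gt_eqF.
have cv : 0 < c^-1 by rewrite invr_gt0.
pose A' x := (c^-1)%:C *: A x.
have [|||S [bS SS S0 SC]] := @abs_contraction A'.
- by move=> a x y; rewrite /A' lA; vector_ring Hip.
- move=> x; rewrite nrZr gtr0_norm// mulrC ler_pdivrMr// mulrC; exact: hc.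
- move=> x y; rewrite (ipZl Hip) (ipZr Hip) sA; congr (_ * _).
  by rewrite /= oppr0.
have [lS _] := bS.
exists (fun x => c%:C *: S x); split=> [|x|x|C bC CA x].
- exact: bounded_scale.
- by rewrite (linopZ lS) SS /A' (linopZ lA) !scalerA mulrAC -mulrA mulrACA cK mulr1 scale1r.
- by rewrite (ripZl Hip) mulr_ge0// ltW.
- have [lC _] := bC; rewrite (linopZ lC) SC// => y.
  by rewrite /A' (linopZ lC) CA.
Qed.

End SquareRoot.

(** * Schur's lemma *)

Section OrthogonalProjection.
Variables (R : realType) (H : normedModType R[i]) (ip : H -> H -> R[i]).
Hypothesis Hip : inner_product ip.
Variables (M : set H) (P : H -> H).
Hypothesis pP : is_orth_proj ip M P.

Lemma orth_proj_unique x m :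
  M m -> (forall y, M y -> ip (x - m) y = 0) -> P x = m.
Proof.
case: pP => cM MP oP Mm om; have sM := cM.1.
apply/eqP; rewrite -subr_eq0; apply/eqP/nr0_eq0/eqP; rewrite -sqrf_eq0; apply/eqP.
have Mz : M (P x - m) by apply: subspaceB.
apply: complexI; rewrite -(ipxx Hip) {1}(_ : P x - m = (x - m) - (x - P x)).
  by rewrite (ipBl Hip) om// oP// subrr.
by rewrite opprB addrC [in RHS]addrC addrA subrK addrC.
Qed.

Lemma orth_proj_id x : M x -> P x = x.
Proof.
by move=> Mx; apply: orth_proj_unique => // y _; rewrite subrr (ip0l Hip).
Qed.

Lemma orth_proj_idem x : P (P x) = P x.
Proof. by apply: orth_proj_id; case: pP. Qed.

Lemma orth_proj_ip x y : M y -> ip (P x) y = ip x y.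
Proof.
case: pP => _ _ oP My.
by apply/esym/eqP; rewrite -subr_eq0 -(ipBl Hip) oP.
Qed.

Lemma orth_proj_sym x y : ip (P x) y = ip x (P y).
Proof.
have [_ MP _] := pP.
by rewrite -(orth_proj_ip x (MP y)) [RHS](ip_conj Hip) (orth_proj_ip y (MP x)) -(ip_conj Hip).
Qed.

Lemma orth_proj_bounded : bounded_op P.
Proof.
have [_ MP _] := pP; apply/bounded_opP; split.
  move=> a x y; apply: (ip_injl Hip) => z.
  by rewrite (ipDl Hip) (ipZl Hip) !orth_proj_sym (ipDl Hip) (ipZl Hip).
exists 1 => // x; rewrite mul1r.
have [->|P0] := eqVneq (nr (P x)) 0; first exact: nr_ge0.
have Pp : 0 < nr (P x) by rewrite lt_def P0 nr_ge0.
rewrite -(ler_pM2r Pp) -expr2 -(ripxx Hip) /rip orth_proj_ip//.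
exact: (rip_le Hip).
Qed.

End OrthogonalProjection.

Section Representation.
Variables (R : realType) (H : completeNormedModType R[i]) (ip : H -> H -> R[i]).
Hypothesis Hip : inner_product ip.
Variables (G : Type) (mul : G -> G -> G) (one : G) (inv : G -> G).
Hypothesis HG : is_group mul one inv.
Variable V : G -> H -> H.
Hypothesis HV : unitary_rep ip mul one V.
Implicit Types (A B C P : H -> H) (M : set H).

Local Notation W := (commutant (range V)).

Lemma commutant_repP A :
  W A <-> bounded_op A /\ forall g x, A (V g x) = V g (A x).
Proof.
split=> -[bA AV]; split=> //; first by move=> g x; apply: AV; exists g.
by move=> _ [g _ <-].
Qed.

Lemma rep_adjoint g x y : ip (V g x) y = ip x (V (inv g) y).
Proof.
have [uV V1 VM] := HV; have [_ _ gV] := HG.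
by have [_ _ <-] := uV (inv g); rewrite -VM gV V1.
Qed.

Lemma rep_adjointV g x y : ip x (V g y) = ip (V (inv g) x) y.
Proof.
have [uV V1 VM] := HV; have [_ _ gV] := HG.
by have [_ _ <-] := uV (inv g); rewrite -VM gV V1.
Qed.

Lemma rep_linear g : linear_op (V g).
Proof. by have [uV _ _] := HV; have [[]] := uV g. Qed.

Lemma commutant_comp A B : W A -> W B -> W (A \o B).
Proof.
move=> /commutant_repP[bA AV] /commutant_repP[bB BV]; apply/commutant_repP.
by split=> [|g x /=]; [exact: bounded_comp|rewrite BV AV].
Qed.

Lemma commutant_id : W id.
Proof. by apply/commutant_repP; split=> //; exact: bounded_id. Qed.

Lemma commutant_lincomb (k : R[i]) A B : W A -> W B -> W (fun x => k *: A x + B x).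
Proof.
move=> /commutant_repP[bA AV] /commutant_repP[bB BV]; apply/commutant_repP.
split=> [|g x /=]; first exact: bounded_lincomb.
by rewrite rep_linear AV BV.
Qed.

Lemma commutant_scale (k : R[i]) A : W A -> W (fun x => k *: A x).
Proof.
move=> /commutant_repP[bA AV]; apply/commutant_repP.
split=> [|g x /=]; first exact: bounded_scale.
by rewrite AV (linopZ (rep_linear g)).
Qed.

(** The adjoint of V(g) is V(g^-1), again in the range of [V]. *)
Lemma commutant_adjoint A B : W A -> bounded_op B ->
  (forall x y, ip (A x) y = ip x (B y)) -> W B.
Proof.
move=> /commutant_repP[bA AV] bB AB; apply/commutant_repP; split=> // g y.
apply: (ip_injr Hip) => x.
by rewrite -AB !rep_adjointV -AV AB.
Qed.

(** Since V(g^-1) preserves [M], V(g) also preserves the orthogonal complement of [M]. *)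
Lemma orth_proj_commutant M P :
  invariant_subspace V M -> is_orth_proj ip M P -> W P.
Proof.
move=> [cM VM] pP; apply/commutant_repP; split; first exact: orth_proj_bounded pP.
move=> g x; have [_ MP oP] := pP.
apply: (orth_proj_unique Hip pP) => [|y My]; first exact/VM/MP.
by rewrite (ipBl Hip) !rep_adjoint -(ipBl Hip) oP//; exact: VM.
Qed.

Section Schur.
Variables (M : set H) (P : H -> H).
Hypotheses (iM : invariant_subspace V M) (irrM : irreducible_on V M).
Hypothesis pP : is_orth_proj ip M P.

(* With S = |A|, the product (S - A)(S + A) vanishes and ker (S - A) is
   invariant, so by irreducibility S = A or S = - A on M. *)
Lemma irreducible_semidefinite A : W A ->
    (forall x y, ip (A x) y = ip x (A y)) -> (forall x, P (A x) = A (P x)) ->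
  (forall x, M x -> 0 <= rip ip (A x) x) \/ (forall x, M x -> rip ip (A x) x <= 0).
Proof.
move=> WA sA PA; have [bA AV] := (commutant_repP A).1 WA.
have [uV _ _] := HV; have [cM VM] := iM; have [_ MP _] := pP.
have [S [bS SS S0 SC]] := abs_exists Hip bA sA.
have SV g x : S (V g x) = V g (S x) by rewrite (SC (V g))//; case: (uV g).
have SP x : P (S x) = S (P x) by apply: SC => //; exact: orth_proj_bounded pP.
have SA x : A (S x) = S (A x) by exact: SC.
have MS x : M x -> M (S x) by move=> /(orth_proj_id Hip pP) <-; rewrite -SP.
have MA x : M x -> M (A x) by move=> /(orth_proj_id Hip pP) <-; rewrite -PA.
have [lA _] := bA; have [lS _] := bS.
pose E x := (-1) *: A x + S x.
have WE : W E by apply: commutant_lincomb => //; apply/commutant_repP.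
have [bE EV] := (commutant_repP E).1 WE.
have [[K0 KD] Kc] := kernel_closed_subspace bE.
pose K := [set x | M x /\ E x = 0].
have iK : invariant_subspace V K.
  split; last first.
    move=> g x [Mx Ex]; split; first exact: VM.
    by rewrite EV Ex (linop0 (rep_linear g)).
  split; last exact: closedI cM.2 Kc.
  split; first by split=> //; exact: subspace0 cM.1.
  by move=> a x y [Mx Ex] [My Ey]; split; [apply: cM.1.2|exact: KD].
have [|K1|KM] := irrM.2 K iK; first by move=> x [].
  right=> x Mx; have : K (S x + A x).
    split; first by apply: (subspaceD cM.1); [exact: MS|exact: MA].
    by rewrite /E (linopD lA) (linopD lS) SS SA; vector_ring Hip.
  rewrite K1 /= => /eqP; rewrite addrC addr_eq0 => /eqP ->.
  by rewrite (ripNl Hip) oppr_le0.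
left=> x; rewrite -KM => -[_ /eqP]; rewrite /E scaleN1r addrC subr_eq0.
by move=> /eqP <-.
Qed.

Lemma schur_symmetric A : W A ->
    (forall x y, ip (A x) y = ip x (A y)) -> (forall x, P (A x) = A (P x)) ->
  exists c : R, forall x, M x -> A x = c%:C *: x.
Proof.
move=> WA sA PA; have [[x1 [Mx1 /eqP x10]] _] := irrM.
have [cM VM] := iM; have [_ MP _] := pP.
have x1p : 0 < nr x1 ^+ 2.
  by rewrite exprn_gt0// lt_def nr_ge0 andbT; apply: contra x10 => /eqP/nr0_eq0 ->.
have [bA AV] := (commutant_repP A).1 WA; have [lA [c0 c00 hc0]] := (bounded_opP A).1 bA.
have [lP _] := orth_proj_bounded Hip pP.
have dich (c : R) : (forall x, M x -> c * nr x ^+ 2 <= rip ip (A x) x) \/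
    (forall x, M x -> rip ip (A x) x <= c * nr x ^+ 2).
  have [||x|h|h] := @irreducible_semidefinite (fun x => (- c)%:C *: id x + A x).
  - by apply: commutant_lincomb => //; exact: commutant_id.
  - move=> x y; rewrite !(ipDl Hip) !(ipDr Hip) (ipZl Hip) (ipZr Hip) sA.
    by congr (_ * _ + _); rewrite /= oppr0.
  - by rewrite lP PA.
  - by left=> x /h; rewrite (ripDl Hip) (ripZl Hip) (ripxx Hip); lra.
  - by right=> x /h; rewrite (ripDl Hip) (ripZl Hip) (ripxx Hip); lra.
pose E := [set c : R | forall x, M x -> c * nr x ^+ 2 <= rip ip (A x) x].
have EU x c : nr x != 0 -> M x -> E c -> c <= rip ip (A x) x / nr x ^+ 2.
  move=> x0 Mx Ec; rewrite ler_pdivlMr; first exact: Ec.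
  by rewrite exprn_gt0// lt_def x0 nr_ge0.
have E0 : E !=set0.
  exists (- c0) => x _; have := rip_abs_le Hip (A x) x.
  rewrite ler_norml => /andP[+ _]; apply: le_trans.
  by rewrite mulNr lerN2 expr2 mulrA ler_wpM2r ?nr_ge0.
have x1n : nr x1 != 0 by apply: contra x10 => /eqP/nr0_eq0 ->.
have hE : has_sup E.
  by split=> //; exists (rip ip (A x1) x1 / nr x1 ^+ 2) => c; exact: EU.
pose m := sup E.
have lo x : M x -> m * nr x ^+ 2 <= rip ip (A x) x.
  move=> Mx; have [x0|x0] := eqVneq (nr x) 0.
    by rewrite (nr0_eq0 x0) (linop0 lA) nr0 expr0n mulr0 /rip (ip0l Hip).
  rewrite -ler_pdivlMr ?exprn_gt0// ?lt_def ?x0 ?nr_ge0//.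
  by apply: ge_sup => // c; exact: EU.
have hi x : M x -> rip ip (A x) x <= m * nr x ^+ 2.
  move=> Mx; rewrite leNgt; apply/negP => mx.
  have [x0|x0] := eqVneq (nr x) 0.
    by move: mx; rewrite (nr0_eq0 x0) (linop0 lA) nr0 expr0n mulr0 /rip (ip0l Hip)
      ltxx.
  have xp : 0 < nr x ^+ 2 by rewrite exprn_gt0// lt_def x0 nr_ge0.
  have rm : m < rip ip (A x) x / nr x ^+ 2 by rewrite ltr_pdivlMr.
  (* Test the midpoint between [m] and the Rayleigh quotient of [x]: as a lower bound it would
     exceed the supremum, as an upper bound it would contradict [x]. *)
  have [h|h] := dich ((m + rip ip (A x) x / nr x ^+ 2) / 2).
    have := ub_le_sup hE.2 h; rewrite -/m; lra.
  have := h x Mx.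
  have -> : (m + rip ip (A x) x / nr x ^+ 2) / 2 * nr x ^+ 2 =
    (m * nr x ^+ 2 + rip ip (A x) x) / 2 by field.
  by lra.
exists m => x Mx; pose F z := A z - m%:C *: z.
have F0 z : M z -> rip ip (F z) z = 0.
  move=> Mz; rewrite (ripBl Hip) (ripZl Hip) (ripxx Hip).
  by have := lo z Mz; have := hi z Mz; lra.
have MF z : M z -> M (F z).
  move=> Mz; apply: (subspaceB cM.1); last exact: subspaceZ cM.1 _ _ Mz.
  by rewrite -(orth_proj_id Hip pP Mz) -PA.
have sF y z : rip ip (F y) z = rip ip y (F z).
  by rewrite (ripBl Hip) (ripBr Hip) (ripZl Hip) (ripZr Hip) /rip sA.
have FD y z : F (y + z) = F y + F z by rewrite /F (linopD lA); vector_ring Hip.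
have FE : F x = A x - m%:C *: x by [].
clearbody F.
(* Polarization: the form of F vanishes on [M], and at x + F x its cross terms add up to 2 |F
   x|^2. *)
have := F0 (x + F x) (subspaceD cM.1 Mx (MF _ Mx)).
rewrite FD !(ripDl Hip) !(ripDr Hip) F0// (F0 (F x))//; last exact: MF.
rewrite (sF (F x) x) (ripxx Hip) => h.
suff : F x = 0 by rewrite FE => /eqP; rewrite subr_eq0 => /eqP.
by apply: nr0_eq0; apply/eqP; rewrite -sqrf_eq0; apply/eqP; lra.
Qed.

End Schur.

(* Schur's lemma makes both B^* B and B B^* scalar, for B := P2 A P1; if B does
   not vanish, a multiple of it is a unitary equivalence. *)
Lemma schur_inequivalent M1 M2 P1 P2 A :
    invariant_subspace V M1 -> irreducible_on V M1 -> is_orth_proj ip M1 P1 ->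
    invariant_subspace V M2 -> irreducible_on V M2 -> is_orth_proj ip M2 P2 ->
    ~ equivalent_on ip V M1 M2 -> W A ->
  forall x, M1 x -> P2 (A x) = 0.
Proof.
move=> i1 irr1 p1 i2 irr2 p2 neq WA.
have W1 := orth_proj_commutant i1 p1; have W2 := orth_proj_commutant i2 p2.
have [bA AV] := (commutant_repP A).1 WA.
have [As bAs AAs] := adjoint_exists Hip bA.
have WAs := commutant_adjoint WA bAs AAs.
have [_ MP1 _] := p1; have [_ MP2 _] := p2.
pose B := P2 \o A \o P1; pose Bs := P1 \o As \o P2.
have WB : W B := commutant_comp (commutant_comp W2 WA) W1.
have WBs : W Bs := commutant_comp (commutant_comp W1 WAs) W2.
have BBs x y : ip (B x) y = ip x (Bs y).
  by rewrite /B /Bs /= (orth_proj_sym Hip p2) AAs (orth_proj_sym Hip p1).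
have BsB x y : ip (Bs x) y = ip x (B y).
  by rewrite (ip_conj Hip) -BBs -(ip_conj Hip).
have [c hc] : exists c : R, forall x, M1 x -> (Bs \o B) x = c%:C *: x.
  apply: (schur_symmetric i1 irr1 p1) => [|x y|x]; first exact: commutant_comp.
    by rewrite /= BsB BBs.
  by rewrite /Bs /B /= !(orth_proj_idem Hip p1).
have [d hd] : exists d : R, forall x, M2 x -> (B \o Bs) x = d%:C *: x.
  apply: (schur_symmetric i2 irr2 p2) => [|x y|x]; first exact: commutant_comp.
    by rewrite /= BBs BsB.
  by rewrite /Bs /B /= !(orth_proj_idem Hip p2).
have [bB BV] := (commutant_repP B).1 WB; have [lB _] := bB.
have [bBs BsV] := (commutant_repP Bs).1 WBs; have [lBs _] := bBs.
have nB x : M1 x -> nr (B x) ^+ 2 = c * nr x ^+ 2.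
  by move=> Mx; rewrite -!(ripxx Hip) -(ripZl Hip) -hc// /rip /= BsB.
have [[x1 [Mx1 /eqP x10]] _] := irr1.
have x1n : nr x1 != 0 by apply: contra x10 => /eqP/nr0_eq0 ->.
have x1p : 0 < nr x1 ^+ 2 by rewrite exprn_gt0// lt_def x1n nr_ge0.
have c0 : 0 <= c by rewrite -(pmulr_lge0 _ x1p) -nB// sqr_ge0.
have [c00|cn] := eqVneq c 0.
  move=> x Mx; have := nB x Mx; rewrite c00 mul0r => /eqP.
  by rewrite sqrf_eq0 => /eqP/nr0_eq0; rewrite /B /= (orth_proj_id Hip p1).
have cp : 0 < c by rewrite lt_def cn.
exfalso; apply: neq.
(* If d = 0, then [Bs] vanishes on [M2] and c x1 = Bs (B x1) = 0, although c > 0. *)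
have dn : d != 0.
  apply/eqP => d0; have nBs y : M2 y -> Bs y = 0.
    move=> My; apply: nr0_eq0; apply/eqP; rewrite -sqrf_eq0 -(ripxx Hip) /rip BsB.
    by rewrite -[B (Bs y)]/((B \o Bs) y) hd// d0 scale0r (ip0r Hip).
  move: x10 => /eqP; apply; apply: nr0_eq0; apply/eqP.
  have := hc x1 Mx1; rewrite /= nBs; last exact: MP2.
  move=> /(congr1 (@nr _ _)); rewrite nr0 nrZr => /esym/eqP.
  by rewrite mulf_eq0 normr_eq0 (negPf cn).
(* On [M1], |B x|^2 = c |x|^2, so this factor makes [B] isometric there; B Bs = d on [M2] supplies
   the preimages. *)
pose s := (Num.sqrt c)^-1.
have s0 : s != 0 by rewrite invr_eq0 gt_eqF// sqrtr_gt0.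
have sc : s ^+ 2 * c = 1 by rewrite exprVn sqr_sqrtr// mulVf.
exists (fun x => s%:C *: B x); split=> [x Mx|y My|a x y Mx My|x y Mx My|g x Mx].
- by apply: subspaceZ; [exact: i2.1.1|exact: MP2].
- exists ((s * d)^-1%:C *: Bs y); split; first by apply: subspaceZ; [exact: i1.1.1|exact: MP1].
  rewrite (linopZ lB) -[B (Bs y)]/((B \o Bs) y) hd// !scalerA -!rmorphM.
  rewrite [_ * _ * d](_ : _ = 1) ?scale1r//; field.
  by rewrite dn s0.
- by rewrite lB; vector_ring Hip.
- rewrite (ipZl Hip) (ipZr Hip) BBs -[Bs (B y)]/((Bs \o B) y) hc// (ipZr Hip) !mulrA.
  have -> : s%:C * conjc s%:C * conjc c%:C = (s ^+ 2 * c)%:C.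
    by rewrite /= !oppr0 -!rmorphM expr2.
  by rewrite sc mul1r.
- by rewrite BV (linopZ (rep_linear g)).
Qed.

(** * Commutant of a multiplicity-free decomposition *)

Section Decomposition.
Variables (N : option nat) (Hn : nat -> set H).
Hypothesis Hdec : rep_decomposition ip V N Hn.
Variable P : nat -> H -> H.
Hypothesis HP : forall k, idx N k -> is_orth_proj ip (Hn k) (P k).

(** For z in the dense span, <x, z> = 0 gives |x|^2 = <x, x - z>, which is at most |x| |x - z|. This
    is how the density of the span turns into equalities of vectors, tested one component at a
    time. *)
Lemma orth_components_eq0 x :
  (forall k, idx N k -> forall y, Hn k y -> ip x y = 0) -> x = 0.
Proof.
move=> xo; apply: (@small_eq0 _ _ 1) => e e0; rewrite mulr1.
have [_ _ _ dense] := Hdec.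
have /closure_nrP/(_ e e0)[y [n [a [v [hv ->]]]]] :
  closure (Defs.span [set x | exists k, idx N k /\ Hn k x]) x by rewrite dense.
set z := \sum_(_ < _) _ => xz.
have xz0 : ip x z = 0.
  rewrite /z; elim/big_ind: _ => [|u w hu hw|j _]; first exact: (ip0r Hip).
    by rewrite (ipDr Hip) hu hw addr0.
  by have [k [Nk kv]] := hv j; rewrite (ipZr Hip) (xo k)// mulr0.
have [->|x0] := eqVneq (nr x) 0; first exact: ltW.
have xp : 0 < nr x by rewrite lt_def x0 nr_ge0.
rewrite -(ler_pM2l xp) -expr2 -(ripxx Hip).
have -> : rip ip x x = rip ip x (x - z) by rewrite (ripBr Hip) [X in _ - X]/rip xz0 subr0.
by rewrite (le_trans (rip_le Hip _ _))// ler_pM2l// ltW.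
Qed.

(** By inequivalence P_l B P_k = 0 for l different from k, hence B P_k = P_k B P_k for every B in
    the commutant. Taking adjoints in this identity for the adjoint of A gives P_k A = P_k A P_k,
    which equals A P_k. *)
Lemma commutant_orth_proj A k : W A -> idx N k ->
  forall x, A (P k x) = P k (A x).
Proof.
move=> WA Nk; have [hi horth hneq _] := Hdec.
have half B : W B -> forall x, B (P k x) = P k (B (P k x)).
  move=> WB x; apply/eqP; rewrite -subr_eq0; apply/eqP.
  have [_ MPk oPk] := HP Nk.
  apply: orth_components_eq0 => l Nl y Hy.
  have [kl|/eqP kl] := eqVneq k l; first by apply: oPk; rewrite kl.
  rewrite (ipBl Hip) (horth k l Nk Nl kl _ y (MPk _) Hy) subr0.
  rewrite -(orth_proj_ip Hip (HP Nl) _ Hy).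
  have [ik rk] := hi k Nk; have [il rl] := hi l Nl.
  rewrite (schur_inequivalent ik rk (HP Nk) il rl (HP Nl) (hneq k l Nk Nl kl) WB)//.
  exact: (ip0l Hip).
have [bA AV] := (commutant_repP A).1 WA.
have [As bAs AAs] := adjoint_exists Hip bA.
have WAs := commutant_adjoint WA bAs AAs.
move=> x; apply: (ip_injl Hip) => z.
rewrite [RHS](orth_proj_sym Hip (HP Nk)) [RHS]AAs (half As)//.
by rewrite -(orth_proj_sym Hip (HP Nk)) -AAs -(orth_proj_sym Hip (HP Nk)) -half.
Qed.

End Decomposition.
End Representation.

(** * Resolvents of self-adjoint operators *)

(** Cayley transform: lam = (1 - i t) / (1 + i t), written out in real and imaginary parts. The real
    part of lam + 1 is 2 / (1 + t^2), so -1 is never reached. *)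
Lemma cayley_real (R : realType) (t : R) : exists lam : R[i],
  [/\ `|lam| = 1, lam <> -1 & 'i * ((lam - 1) / (lam + 1)) = t%:C].
Proof.
have t2 : 0 < 1 + t ^+ 2 by rewrite ltr_pwDl// sqr_ge0.
have t20 := lt0r_neq0 t2.
pose lam : R[i] := ((1 - t ^+ 2) / (1 + t ^+ 2)) +i* (- (2 * t) / (1 + t ^+ 2)).
have lam1 : lam + 1 != 0.
  rewrite eq_complex /= negb_and; apply/orP; left.
  have -> : (1 - t ^+ 2) / (1 + t ^+ 2) + 1 = 2 / (1 + t ^+ 2) by field.
  by rewrite mulf_neq0// invr_eq0.
exists lam; split.
- rewrite normc_def /=.
  have -> : ((1 - t ^+ 2) / (1 + t ^+ 2)) ^+ 2 + (- (2 * t) / (1 + t ^+ 2)) ^+ 2 = 1.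
    by field.
  by rewrite sqrtr1.
- by move=> h; move: lam1; rewrite h addNr eqxx.
- rewrite mulrA; apply: (canLR (mulfK lam1)).
  apply/eqP; rewrite eq_complex /=; apply/andP; split; apply/eqP; field; exact: t20.
Qed.

Section BoundedSum.
Variables (R : realType) (H : normedModType R[i]).

Lemma bounded_sum (I : Type) (r : seq I) (F : I -> H -> H) :
  (forall j, bounded_op (F j)) -> bounded_op (fun x => \sum_(j <- r) F j x).
Proof.
move=> bF; elim: r => [|j r IH].
  under eq_fun => x do rewrite big_nil -[0](scale0r x).
  exact: bounded_scale (bounded_id H).
under eq_fun do rewrite big_cons -[F j _]scale1r.
exact: bounded_lincomb.
Qed.

End BoundedSum.

Section SelfAdjoint.
Variables (R : realType) (H : completeNormedModType R[i]) (ip : H -> H -> R[i]).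
Hypothesis Hip : inner_product ip.
Variables (D : set H) (T : H -> H).
Hypothesis HT : densely_defined D T.
Hypothesis Tsa : self_adjoint ip D T.

Let sD : Defs.subspace D. Proof. by case: HT. Qed.

Let TD (a : R[i]) x y : D x -> D y -> T (a *: x + y) = a *: T x + T y.
Proof. by case: HT => _ _; exact. Qed.

Lemma densely_defined0 : T 0 = 0.
Proof.
have D0 := subspace0 sD; have := TD 1 D0 D0; rewrite !scale1r addr0 => h.
by apply: (@addrI _ (T 0)); rewrite -h addr0.
Qed.

Let TZ (a : R[i]) x : D x -> T (a *: x) = a *: T x.
Proof.
by move=> Dx; have := TD a Dx (subspace0 sD); rewrite densely_defined0 !addr0.
Qed.

Let TB x y : D x -> D y -> T (x - y) = T x - T y.
Proof.
by move=> Dx Dy; rewrite addrC -scaleN1r TD// scaleN1r addrC.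
Qed.

Lemma dense_domain_eq0 z : (forall u, D u -> ip u z = 0) -> z = 0.
Proof.
move=> zo; apply: (@small_eq0 _ _ 1) => e e0; rewrite mulr1.
have [_ dD _] := HT.
have /closure_nrP/(_ e e0)[u Du zu] : closure D z by rewrite dD.
have [->|z0] := eqVneq (nr z) 0; first exact: ltW.
have zp : 0 < nr z by rewrite lt_def z0 nr_ge0.
rewrite -(ler_pM2r zp) -expr2 -(ripxx Hip).
have -> : rip ip z z = rip ip (z - u) z by rewrite (ripBl Hip) [X in _ - X]/rip zo// subr0.
by rewrite (le_trans (rip_le Hip _ _))// ler_pM2r// ltW.
Qed.

(** Turns a weak equation into membership in [D], through the inclusion of the adjoint domain in
    [D]; density then determines the value. *)
Lemma self_adjoint_weak y z :
  (forall u, D u -> ip (T u) y = ip u z) -> D y /\ T y = z.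
Proof.
have [adj sym] := Tsa => yz.
have Dy : D y by rewrite -adj; exists z.
split=> //; apply/eqP; rewrite -subr_eq0; apply/eqP/dense_domain_eq0 => u Du.
by rewrite (ipBr Hip) -sym// yz// subrr.
Qed.

Section Shift.
Variable b : R.
Hypothesis b2 : b ^+ 2 = 1.
(** The shift is i or -i. Both are treated at once, because the two resolvents are adjoint to each
    other. *)
Let w : R[i] := 0 +i* b.

Let wC : conjc w = - w.
Proof. by apply/eqP; rewrite eq_complex /= oppr0 !eqxx. Qed.

Let nw : complex.Re `|w| = 1.
Proof. by rewrite normc_def /= expr0n add0r b2 sqrtr1. Qed.

(** By symmetry <T x, x> is real, while [w] is purely imaginary, so the cross term vanishes. *)
Lemma nr_shift x : D x -> nr (T x + w *: x) ^+ 2 = nr (T x) ^+ 2 + nr x ^+ 2.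
Proof.
move=> Dx; rewrite (nrD2 Hip) nrZ nw mul1r.
suff -> : rip ip (T x) (w *: x) = 0 by rewrite mulr0 addr0.
have [_ sym] := Tsa; have := sym x x Dx Dx; rewrite (ip_conj Hip (T x)).
rewrite /rip (ipZr Hip) wC; case: (ip (T x) x) => u v [] /= h.
have -> : v = 0 by lra.
by rewrite mulr0 oppr0 mul0r addr0.
Qed.

Lemma nr_le_shift x : D x -> nr x <= nr (T x + w *: x).
Proof.
move=> Dx; rewrite -(@ler_pXn2r _ 2) ?nnegrE ?nr_ge0// nr_shift//.
by rewrite lerDr sqr_ge0.
Qed.

(** T + w is bounded below, so preimages of a convergent sequence are Cauchy. That their limit lies
    in [D] with the right image is closedness of [T], obtained by passing to the limit in <T u, x n>
    = <u, T (x n)>. *)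
Lemma shift_range_closed : closed_subspace [set T x + w *: x | x in D].
Proof.
split.
  split; first by exists 0; [exact: subspace0|rewrite densely_defined0 scaler0 addr0].
  move=> a _ _ [x Dx <-] [y Dy <-]; exists (a *: x + y); first exact: sD.2.
  by rewrite TD//; vector_ring Hip.
apply/closedP => y hy; pose e n : R := n.+1%:R^-1.
have e0 n : 0 < e n by rewrite invr_gt0.
have /choice[x xP] : forall n, exists x, D x /\ nr (y - (T x + w *: x)) < e n.
  by move=> n; have [_ [x Dx <-] xy] := hy _ (e0 n); exists x.
have sB m n : T (x m) + w *: x m - (T (x n) + w *: x n) =
    T (x m - x n) + w *: (x m - x n).
  by rewrite TB; [vector_ring Hip|case: (xP m)|case: (xP n)].
have [||l xl] := @nr_complete _ _ x e.
- by move=> a a0; exact: inv_nat_small.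
- move=> m n; have [Dm hm] := xP m; have [Dn hn] := xP n.
  apply: le_trans (nr_le_shift (subspaceB sD Dm Dn)) _; rewrite -sB.
  have := ler_nrD (T (x m) + w *: x m - y) (y - (T (x n) + w *: x n)).
  by rewrite addrA subrK (nrB _ y); lra.
have [Dl Tl] : D l /\ T l = y - w *: l.
  apply: self_adjoint_weak; suff h u : D u -> rip ip (T u) l = rip ip u (y - w *: l).
    by move=> u Du; apply: (rip_ext Hip) => c; rewrite -TZ// h//; exact: subspaceZ.
  move=> Du; apply/eqP; rewrite -subr_eq0 -normr_eq0 eq_le normr_ge0 andbT.
  apply/ler_addgt0Pl => a a0; rewrite addr0.
  have K0 : 0 < nr (T u) + nr u + nr u + 1.
    by have := nr_ge0 u; have := nr_ge0 (T u); lra.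
  have [n /(_ n (leqnn n)) nP] := inv_nat_small (divr_gt0 a0 K0).
  move: nP; rewrite ltr_pdivlMr// -/(e n) => nP.
  have [Dn hn] := xP n.
  have -> : rip ip (T u) l - rip ip u (y - w *: l) = rip ip (T u) (l - x n) +
      (rip ip u (w *: (l - x n)) - rip ip u (y - (T (x n) + w *: x n))).
    rewrite scalerBr !(ripDr Hip, ripNr Hip).
    have -> : rip ip u (T (x n)) = rip ip (T u) (x n) by rewrite /rip Tsa.2.
    by ring.
  have h1 := rip_abs_le Hip (T u) (l - x n).
  have h2 := rip_abs_le Hip u (w *: (l - x n)).
  have h3 := rip_abs_le Hip u (y - (T (x n) + w *: x n)).
  rewrite nrZ nw mul1r in h2.
  have lx : nr (l - x n) <= e n by rewrite nrB.
  have h4 := ler_wpM2l (nr_ge0 (T u)) lx.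
  have h5 := ler_wpM2l (nr_ge0 u) lx.
  have h6 := ler_wpM2l (nr_ge0 u) (ltW hn).
  rewrite (le_trans (ler_normD _ _))// (le_trans (lerD (lexx _) (ler_normB _ _)))//.
  by have := e0 n; lra.
by exists l => //; rewrite Tl subrK.
Qed.

(** A vector z orthogonal to the closed range satisfies T z = w z. Then [nr_shift] reads 4 |z|^2 = 2
    |z|^2, so z = 0. *)
Lemma shift_surjective y : exists2 x, D x & T x + w *: x = y.
Proof.
have [_ [x Dx <-] xP] := projection_exists Hip shift_range_closed y.
exists x => //; apply/esym/eqP; rewrite -subr_eq0; apply/eqP.
set z := y - _ in xP *.
have [Dz Tz] : D z /\ T z = w *: z.
  apply: self_adjoint_weak => u Du.
  have : ip z (T u + w *: u) = 0 by apply: xP; exists u.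
  rewrite (ip_conj Hip) (ipDl Hip) (ipZl Hip) (ipZr Hip) wC => /(congr1 conjc).
  by rewrite conjcK conjc0 mulNr => /eqP; rewrite addr_eq0 => /eqP.
have := nr_shift Dz; rewrite Tz -scalerDl !nrZ nw exprMn mul1r.
have -> : complex.Re `|w + w| ^+ 2 = 4.
  by rewrite normc_def /= sqr_sqrtr ?addr_ge0 ?sqr_ge0//; have := b2; nra.
by move=> h; apply: nr0_eq0; apply/eqP; rewrite -sqrf_eq0; apply/eqP; lra.
Qed.

Lemma resolvent_exists : exists Q : H -> H,
  [/\ bounded_op Q, forall y, D (Q y), forall y, T (Q y) + w *: Q y = y
    & forall x, D x -> Q (T x + w *: x) = x].
Proof.
have /choice[Q QP] : forall y, exists x, D x /\ T x + w *: x = y.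
  by move=> y; have [x] := shift_surjective y; exists x.
have DQ y := (QP y).1; have QK y := (QP y).2.
have KQ x : D x -> Q (T x + w *: x) = x.
  move=> Dx; set y := T x + _; apply/eqP; rewrite -subr_eq0; apply/eqP/nr0_eq0.
  have := nr_le_shift (subspaceB sD (DQ y) Dx); rewrite TB//.
  have -> : T (Q y) - T x + w *: (Q y - x) = T (Q y) + w *: Q y - y by rewrite /y; vector_ring Hip.
  by rewrite QK subrr nr0 => h; apply/eqP; rewrite eq_le h nr_ge0.
exists Q; split=> //; apply/bounded_opP; split.
  move=> a x y; rewrite -[RHS]KQ; last exact: sD.2.
  rewrite TD//; congr Q; rewrite -{1}[x]QK -{1}[y]QK; vector_ring Hip.
by exists 1 => // y; rewrite mul1r -{2}[y]QK nr_le_shift.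
Qed.

End Shift.
End SelfAdjoint.

(** * Invariant self-adjoint operators *)

Section InvariantOperator.
Variables (R : realType) (H : completeNormedModType R[i]) (ip : H -> H -> R[i]).
Hypothesis Hip : inner_product ip.
Variables (G : Type) (mul : G -> G -> G) (one : G) (inv : G -> G).
Hypothesis HG : is_group mul one inv.
Variable V : G -> H -> H.
Hypothesis HV : unitary_rep ip mul one V.
Variables (N : option nat) (Hn : nat -> set H).
Hypothesis Hdec : rep_decomposition ip V N Hn.
Variable P : nat -> H -> H.
Hypothesis HP : forall k, idx N k -> is_orth_proj ip (Hn k) (P k).
Variables (D : set H) (T : H -> H).
Hypothesis HT : densely_defined D T.
Hypothesis Tsa : self_adjoint ip D T.
Hypothesis TG : G_invariant V D T.

Local Notation W := (commutant (range V)).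

Lemma resolvent_commutant (w : R[i]) (Q : H -> H) : bounded_op Q ->
    (forall y, D (Q y)) -> (forall y, T (Q y) + w *: Q y = y) ->
    (forall x, D x -> Q (T x + w *: x) = x) -> W Q.
Proof.
move=> bQ DQ QK KQ; apply/commutant_repP; split=> // g y.
have [DV TV] := TG g.
rewrite -[RHS]KQ; last exact: DV.
by rewrite TV// -(linopZ (rep_linear HV g)) -(linopD (rep_linear HV g)) QK.
Qed.

(** [D] is the range of the resolvent [Q], so P_k Q = Q P_k sends [D] into itself; applying T + i
    and cancelling the shift gives the commutation. *)
Lemma component_op_commutant k : idx N k -> op_commutant D T (P k).
Proof.
move=> Nk; have bP := orth_proj_bounded Hip (HP Nk); have [lP _] := bP.
have [Q [bQ DQ QK KQ]] := resolvent_exists Hip HT Tsa (expr1n R 2).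
have WQ := resolvent_commutant bQ DQ QK KQ.
have QP := commutant_orth_proj Hip HG HV Hdec HP WQ Nk.
have PQ x : D x -> P k x = Q (P k (T x + (0 +i* 1) *: x)).
  by move=> Dx; rewrite QP KQ.
split=> // x Dx; first by rewrite PQ.
have := QK (P k (T x + (0 +i* 1) *: x)); rewrite -PQ//.
by rewrite (linopD lP) (linopZ lP) => /addIr.
Qed.

(* The self-adjoint real and imaginary parts of the resolvent (T + i)^-1 are
   scalar on each component, hence so is T. *)
Lemma component_scalar k : idx N k ->
  exists t : R, forall x, Hn k x -> D x /\ T x = t%:C *: x.
Proof.
move=> Nk; have [hi _ _ _] := Hdec; have [ik rk] := hi k Nk.
have m1 : (-1) ^+ 2 = 1 :> R by rewrite sqrrN expr1n.
have [Q [bQ DQ QK KQ]] := resolvent_exists Hip HT Tsa (expr1n R 2).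
have [Q' [bQ' DQ' QK' KQ']] := resolvent_exists Hip HT Tsa m1.
have WQ := resolvent_commutant bQ DQ QK KQ.
have WQ' := resolvent_commutant bQ' DQ' QK' KQ'.
have [_ sym] := Tsa; have [lQ _] := bQ; have [lQ' _] := bQ'.
(* Write x = (T + i) Q x and y = (T - i) Q' y, then use the symmetry of [T]. *)
have QQ' x y : ip (Q x) y = ip x (Q' y).
  rewrite -{1}(QK' y) -{2}(QK x) (ipDr Hip) (ipDl Hip) (ipZr Hip) (ipZl Hip) sym//.
  by congr (_ + _ * _); rewrite /= opprK.
have Q'Q x y : ip (Q' x) y = ip x (Q y).
  by rewrite (ip_conj Hip) -QQ' -(ip_conj Hip).
have PQ := commutant_orth_proj Hip HG HV Hdec HP WQ Nk.
have PQ' := commutant_orth_proj Hip HG HV Hdec HP WQ' Nk.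
have [lP _] := orth_proj_bounded Hip (HP Nk).
(* Twice the real and twice the imaginary part of [Q], whence the halving in [r] below. The factor 1
   fits the shape of [commutant_lincomb]. *)
pose A x := 1 *: Q x + Q' x; pose B x := (- 'i) *: Q x + 'i *: Q' x.
have [c hc] : exists c : R, forall x, Hn k x -> A x = c%:C *: x.
  apply: (schur_symmetric Hip HV ik rk (HP Nk)).
  - exact: commutant_lincomb HV _ _ _ WQ WQ'.
  - by move=> x y; rewrite /A !scale1r (ipDl Hip) (ipDr Hip) QQ' Q'Q addrC.
  - by move=> x; rewrite /A !scale1r (linopD lP) -PQ -PQ'.
have [d hd] : exists d : R, forall x, Hn k x -> B x = d%:C *: x.
  apply: (schur_symmetric Hip HV ik rk (HP Nk)).
  - exact: commutant_lincomb HV _ _ _ WQ (commutant_scale HV _ WQ').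
  - move=> x y; rewrite /B (ipDl Hip) (ipDr Hip) !(ipZl Hip) !(ipZr Hip) QQ' Q'Q addrC.
    by congr (_ * _ + _ * _); apply/eqP; rewrite eq_complex /= ?opprK ?oppr0 !eqxx.
  - by move=> x; rewrite /B (linopD lP) !(linopZ lP) -PQ -PQ'.
have i2 : 'i * 'i = -1 :> R[i] by rewrite -expr2 sqr_i.
pose r : R[i] := (c%:C + 'i * d%:C) / 2.
have Qr x : Hn k x -> Q x = r *: x.
  move=> Hx; have -> : Q x = 2^-1 *: (A x + 'i *: B x).
    apply: (ip_injl Hip) => z; rewrite /A /B !(ipDl Hip, ipZl Hip).
    rewrite (_ : 'i * _ = ('i * 'i) * (ip (Q' x) z - ip (Q x) z)); last by ring.
    by rewrite i2; field.
  by rewrite hc// hd// scalerA -scalerDl scalerA mulrC.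
have [[x1 [Hx1 x10]] _] := rk.
(* Q is injective: if it killed x1, then x1 = (T + i) Q x1 would be 0. *)
have r0 : r != 0.
  apply/eqP => r0; apply: x10; have := QK x1; rewrite Qr// r0 scale0r scaler0 addr0.
  by rewrite (densely_defined0 HT).
have DT x : Hn k x -> D x /\ T x = (r^-1 - 'i) *: x.
  move=> Hx; have xQ : x = Q (r^-1 *: x).
    by rewrite (linopZ lQ) Qr// scalerA mulVf// scale1r.
  split; first by rewrite xQ.
  have := QK (r^-1 *: x); rewrite -xQ => /eqP; rewrite eq_sym -subr_eq => /eqP <-.
  by rewrite scalerBl.
set tau := r^-1 - 'i in DT.
have [Dx1 Tx1] := DT x1 Hx1.
(* Symmetry of [T] at the nonzero vector x1 shows that tau equals its conjugate. *)
have := sym x1 x1 Dx1 Dx1; rewrite Tx1 (ipZl Hip) (ipZr Hip) => /mulIf tauC.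
exists (complex.Re tau) => x /DT[Dx ->]; split=> //; congr (_ *: _).
have : ip x1 x1 != 0.
  rewrite (ipxx Hip); apply/eqP => /complexI/eqP; rewrite sqrf_eq0 => /eqP.
  by move/nr0_eq0.
move=> /tauC; case: (tau) => u v [] h; apply/eqP; rewrite eq_complex /= eqxx /=.
by apply/eqP; lra.
Qed.

End InvariantOperator.

Theorem theorem5p7 (R : realType) (H : completeNormedModType R[i])
  (ip : H -> H -> R[i]) (Hip : inner_product ip) (Hsep : separable H)
  (G : Type) (mul : G -> G -> G) (one : G) (inv : G -> G)
  (HG : is_group mul one inv)
  (V : G -> H -> H) (HV : unitary_rep ip mul one V)
  (N : option nat) (Hn : nat -> set H) (Hdec : rep_decomposition ip V N Hn)
  (P : nat -> H -> H) (HP : forall k, idx N k -> is_orth_proj ip (Hn k) (P k))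
  (D : set H) (T : H -> H) (HT : densely_defined D T)
  (Tsa : self_adjoint ip D T) (TG : G_invariant V D T) :
  let Vcal := commutant (commutant (range V)) in
  (forall k, idx N k ->
     [/\ Vcal (P k), commutant Vcal (P k) & op_commutant D T (P k)]) /\
  (forall n : nat, N = Some n ->
     [/\ D = [set: H], bounded_op T &
       exists lam : nat -> R[i],
         (forall k, (k < n)%N -> `|lam k| = 1 /\ lam k <> -1) /\
         forall x, T x = \sum_(k < n) ('i * ((lam k - 1) / (lam k + 1))) *: P k x]).
Proof.
have [hi horth _ _] := Hdec.
split=> [k Nk|n Nn].
  have bP := orth_proj_bounded Hip (HP k Nk).
  split; last exact (component_op_commutant Hip HG HV Hdec HP HT Tsa TG Nk).
    split=> // A WA x.
    by rewrite (commutant_orth_proj Hip HG HV Hdec HP WA Nk).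
  split=> // A [_ AW] x; apply/esym/AW.
  exact (orth_proj_commutant Hip HG HV (hi k Nk).1 (HP k Nk)).
have Nk (k : 'I_n) : idx N k by rewrite Nn /=.
(* The scalar is set to 0 for indices from n on, to have a total function. *)
have /choice[t tP] : forall k, exists t : R, forall x, (k < n)%N -> Hn k x ->
    D x /\ T x = t%:C *: x.
  move=> k; have [kn|kn] := boolP (k < n)%N; last by exists 0.
  have Nk' : idx N k by rewrite Nn.
  have [t ht] := component_scalar Hip HG HV Hdec HP HT Tsa TG Nk'.
  by exists t => x _; exact: ht.
have /choice[lam lamP] := fun k => cayley_real (t k).
(* The remainder is orthogonal to every component: paired with H_l, only the term [P l x] survives,
   and it cancels against [x]. *)
have sumP x : \sum_(k < n) P k x = x.
  apply/esym/eqP; rewrite -subr_eq0; apply/eqP.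
  apply: (orth_components_eq0 Hip Hdec) => l; rewrite Nn /= => ln y Hy.
  pose j := Ordinal ln; rewrite (bigD1 j)//= opprD addrA (ipBl Hip).
  have [_ _ ->//] := HP j (Nk j); rewrite sub0r.
  suff -> : ip (\sum_(k < n | k != j) P k x) y = 0 by rewrite oppr0.
  elim/big_ind: _ => [|u v hu hv|k kj]; first exact: (ip0l Hip).
    by rewrite (ipDl Hip) hu hv addr0.
  have [_ MP _] := HP k (Nk k).
  apply: (horth k j) => //; first by move/val_inj => kj'; rewrite kj' eqxx in kj.
have [sD _ TD] := HT.
(* Here N is finite: the subspace [D] contains every component, hence all finite sums, hence the
   whole space. *)
have DT x : D x /\ T x = \sum_(k < n) (t k)%:C *: P k x.
  rewrite -{1 2}[x]sumP; elim/big_ind2: _ => [|u' u v' v [Du Tu] [Dv Tv]|k _].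
  - by split; [exact: subspace0|exact: densely_defined0 HT].
  - by split; [exact: subspaceD|have := TD 1 u v Du Dv; rewrite !scale1r Tu Tv].
  - by apply: tP => //; have [_ MP _] := HP k (Nk k).
have TE x : T x = \sum_(k < n) (t k)%:C *: P k x by have [] := DT x.
split; first by apply/seteqP; split=> x // _; have [] := DT x.
  have -> : T = fun x => \sum_(k < n) (t k)%:C *: P k x by exact/funext.
  apply: bounded_sum => k; apply: bounded_scale.
  exact (orth_proj_bounded Hip (HP k (Nk k))).
exists lam; split=> [k _|x]; first by have [] := lamP k.
by rewrite TE; apply: eq_bigr => k _; have [_ _ ->] := lamP k.
Qed.
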